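(* For all integers $J\ge 0$ and $N\ge 0$, $$MO(2,25J+12;625N+250)\equiv 0\pmod 5\qquad\text{and}\qquad MO(2,25J+12;625N+375)\equiv 0\pmod 5.$$
   Context: For an integer $a$ and a nonnegative integer $t$, define $MO(a,t;n)$ by the formal power series identity $$\sum_{n\ge 0}MO(a,t;n)\,q^n=\sum_{1\le n_1<n_2<\cdots<n_t}\frac{q^{n_1+n_2+\cdots+n_t}}{\prod_{k=1}^t(1+aq^{n_k}+q^{2n_k})},$$ where each factor $1/(1+aq^{m}+q^{2m})$ is expanded as a power series in $q$ with integer coefficients. *)

(* Defs.v *)
From mathcomp Require Import all_boot all_order all_algebra.

Set Implicit Arguments.
Unset Strict Implicit.
Unset Printing Implicit Defensive.

Import Order.TTheory GRing.Theory Num.Theory.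
Local Open Scope ring_scope.

(* A formal power series in q is the function n |-> coefficient of q^n. *)
Definition fps (R : Type) := nat -> R.

Definition fps_poly (R : nzRingType) (p : {poly R}) : fps R := fun n => p`_n.

Definition fps_mul (R : nzRingType) (f g : fps R) : fps R :=
  fun n => \sum_(i < n.+1) f i * g (n - i)%N.

(* Coefficients 0..n of 1/f for f with constant term 1, obtained by solving
   f * g = 1 for the coefficients of g one at a time. *)
Fixpoint fps_inv_coefs (R : nzRingType) (f : fps R) (n : nat) : seq R :=
  if n is m.+1 then
    let s := fps_inv_coefs f m in
    rcons s (- \sum_(i < m.+1) f i.+1 * s`_(m - i))
  else [:: 1].

(* Meaningful only if f has constant term 1: see fps_mulV. *)
Definition fps_inv (R : nzRingType) (f : fps R) : fps R :=
  fun n => (fps_inv_coefs f n)`_n.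

Lemma size_fps_inv_coefs (R : nzRingType) (f : fps R) n :
  size (fps_inv_coefs f n) = n.+1.
Proof. by elim: n => //= n IHn; rewrite size_rcons IHn. Qed.

Lemma nth_fps_inv_coefs (R : nzRingType) (f : fps R) n k :
  (k <= n)%N -> (fps_inv_coefs f n)`_k = fps_inv f k.
Proof.
elim: n => [|n IHn]; first by rewrite leqn0 => /eqP->.
rewrite leq_eqVlt => /predU1P[-> //|lt_kn].
by rewrite /= nth_rcons size_fps_inv_coefs lt_kn IHn.
Qed.

Lemma fps_inv0 (R : nzRingType) (f : fps R) : fps_inv f 0 = 1.
Proof. by []. Qed.

Lemma fps_invS (R : nzRingType) (f : fps R) n :
  fps_inv f n.+1 = - \sum_(i < n.+1) f i.+1 * fps_inv f (n - i)%N.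
Proof.
rewrite {1}/fps_inv /= nth_rcons size_fps_inv_coefs ltnn eqxx.
by congr (- _); apply: eq_bigr => i _; rewrite nth_fps_inv_coefs ?leq_subr.
Qed.

Lemma fps_mulV (R : nzRingType) (f : fps R) :
  f 0 = 1 -> fps_mul f (fps_inv f) =1 fps_poly 1.
Proof.
move=> f0 [|n]; rewrite /fps_mul /fps_poly coef1 big_ord_recl f0 mul1r.
  by rewrite big_ord0 addr0.
by rewrite subn0 fps_invS addNr.
Qed.

(* The denominator 1 + a q^m + q^(2m); its constant term is 1 when m > 0. *)
Definition MO_den (a : int) (m : nat) : {poly int} :=
  1 + a *: 'X^m + 'X^(2 * m).

Lemma MO_den0 a m : (0 < m)%N -> fps_poly (MO_den a m) 0 = 1.
Proof.
move=> m_gt0; rewrite /fps_poly /MO_den !coefD coefZ !coefXn coef1 eqxx.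
by rewrite ![0%N == _]eq_sym muln_eq0 /= (gtn_eqF m_gt0) mulr0 !addr0.
Qed.

(* The indices n_1 < ... < n_t are encoded as the set of the n_k - 1, so that
   A ranges over the sets with 1 <= n_k <= K. *)
Definition MO_term (a : int) (K : nat) (A : {set 'I_K}) : fps int :=
  fps_mul (fps_poly 'X^(\sum_(i in A) i.+1))
          (\big[@fps_mul int/fps_poly 1]_(i in A)
              fps_inv (fps_poly (MO_den a i.+1))).

Definition MO_partial (a : int) (t K : nat) : fps int :=
  fun n => \sum_(A : {set 'I_K} | #|A| == t) MO_term a A n.

(* Terms with some n_k > n do not contribute to the coefficient of q^n, so the
   partial sum at K = n already has the coefficient of the whole infinite sum:
   see MO_partial_stable. *)
Definition MO (a : int) (t n : nat) : int := MO_partial a t n n.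

Lemma MO_term_eq0 a K (A : {set 'I_K}) n :
  (n < \sum_(i in A) i.+1)%N -> MO_term a A n = 0.
Proof.
move=> lt_nA; rewrite /MO_term {1}/fps_mul big1 // => i _.
rewrite /fps_poly coefXn ltn_eqF ?mul0r //.
by apply: leq_ltn_trans lt_nA; rewrite -ltnS.
Qed.

Lemma MO_partialS a t K n :
  (n <= K)%N -> MO_partial a t K.+1 n = MO_partial a t K n.
Proof.
move=> le_nK; pose w := widen_ord (leqnSn K).
have w_inj : injective w by move=> i j /(congr1 val) /= /val_inj.
rewrite /MO_partial (bigID (fun A : {set 'I_K.+1} => ord_max \in A)) /=.
rewrite big1 ?add0r => [|A /andP[_ maxA]]; last first.
  by rewrite MO_term_eq0 // (bigD1 ord_max) //= ltn_addr.
rewrite (reindex_onto (fun B : {set 'I_K} => w @: B)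
                      (fun A : {set 'I_K.+1} => w @^-1: A)) /=; last first.
  move=> A /andP[_ maxA]; apply/setP=> i; apply/imsetP/idP => [[j]|iA].
    by rewrite inE => ? ->.
  have lt_iK : (i < K)%N.
    rewrite ltn_neqAle -ltnS ltn_ord andbT; apply: contraNneq maxA => iK.
    by have <- : i = ord_max by apply: val_inj.
  have wi : w (Ordinal lt_iK) = i by apply: val_inj.
  by exists (Ordinal lt_iK); rewrite ?inE wi.
have wmax (B : {set 'I_K}) : ord_max \notin w @: B.
  by apply/imsetP=> -[j _ /(congr1 val) /= Kj]; have := ltn_ord j; rewrite -Kj ltnn.
apply: eq_big => [B|B _].
  have -> : w @^-1: (w @: B) = B by apply/setP=> i; rewrite inE mem_imset.
  by rewrite card_imset // wmax eqxx !andbT.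
have inwB i : (i \in w @: B) = (i \in w @: B) && (i < K)%N.
  rewrite andb_idr // => /imsetP[j _ ->]; exact: (ltn_ord j).
have narrow T (op : T -> T -> T) x (F : nat -> T) :
    \big[op/x]_(i in w @: B) F i = \big[op/x]_(i in B) F i.
  rewrite (eq_bigl _ _ inwB) (big_ord_narrow_cond (leqnSn K)) /=.
  by apply: eq_bigl => i; rewrite mem_imset.
rewrite /MO_term; congr (fps_mul (fps_poly 'X^_) _ _).
  exact: (narrow _ _ _ S).
exact: (narrow _ _ _ (fun i => fps_inv (fps_poly (MO_den a i.+1)))).
Qed.

Lemma MO_partial_stable a t n K :
  (n <= K)%N -> MO_partial a t K n = MO a t n.
Proof.
elim: K => [|K IHK]; first by rewrite leqn0 => /eqP->.
rewrite leq_eqVlt => /predU1P[-> //|le_nK].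
by rewrite MO_partialS ?IHK.
Qed.

(* Main.v *)
(* With T m = 'C(m.+1, 2) and psi = \sum_m q^(T m), the finite Jacobi triple product
     \prod_(1 <= k <= n) ((1 + q^k)^2 + x q^k)
       = \sum_(m <= n) [2n+1, n-m]_q q^(T m) \sum_k 'C(m+k, 2k) x^k
   gives, by comparing the coefficients of x^t and x^0 as n grows,
     psi * \sum_n MO(2,t;n) q^n = \sum_m 'C(m+t, 2t) q^(T m).
   For t = 25J+12 the binomial vanishes mod 5 unless m = 12 mod 25, in which case
   T m = 78 mod 625; so it is enough that the coefficients of 1/psi at 625k+172 and
   625k+297 vanish mod 5.

   Let U r extract the coefficients of index r mod 5, and let a = U 0 psi, b = U 1 psi,
   c = U 3 psi = psi(q^5); U 2 psi = U 4 psi = 0.  Multiplication by 2 + i on Gaussian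
   integers with odd coordinates yields a b + q c^2 = psi^2.  Modulo 5 this implies
   U 2 (1/psi) = U 2 (psi^4) / psi = psi^3, then U 4 (psi^3) = psi^2 psi(q^5), then
   U 1 (psi^2 psi(q^5)) = 2 psi^3 - q psi psi(q^5)^2 =: W, and finally
   U 1 W = 5 a psi^2 = 0 and U 2 W = 5 b psi^2 = 0. *)
Require Import Defs.
From HB Require Import structures.
From mathcomp Require Import all_boot all_order all_algebra.
From mathcomp Require Import boolp.
From mathcomp Require Import zify ring.

Set Implicit Arguments.
Unset Strict Implicit.
Unset Printing Implicit Defensive.

Import GRing.Theory Num.Theory.
Local Open Scope ring_scope.

(** * The ring of formal power series *)

HB.instance Definition _ (R : Type) := gen_eqMixin (fps R).
HB.instance Definition _ (R : Type) := gen_choiceMixin (fps R).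

Section FpsZmodule.
Variable R : nzRingType.
Implicit Types f g h : fps R.

Definition fps_add f g : fps R := fun n => f n + g n.
Definition fps_opp f : fps R := fun n => - f n.

Fact fps_addA : associative fps_add.
Proof. by move=> f g h; apply/funext => n; apply: addrA. Qed.
Fact fps_addC : commutative fps_add.
Proof. by move=> f g; apply/funext => n; apply: addrC. Qed.
Fact fps_add0 : left_id (fps_poly 0) fps_add.
Proof. by move=> f; apply/funext => n; rewrite /fps_add /fps_poly coef0 add0r. Qed.
Fact fps_addN : left_inverse (fps_poly 0) fps_opp fps_add.
Proof. by move=> f; apply/funext => n; rewrite /fps_add /fps_poly coef0 addNr. Qed.

HB.instance Definition _ := GRing.isZmodule.Build (fps R)
  fps_addA fps_addC fps_add0 fps_addN.

End FpsZmodule.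

Section FpsRing.
Variable R : comNzRingType.
Implicit Types f g h : fps R.

(** Coefficient [n] of a product only sees coefficients up to [n] of the factors, so the ring laws
    carry over from [{poly R}] by truncation. *)
Definition agree_upto n f (p : {poly R}) := forall i, (i <= n)%N -> f i = p`_i.

Lemma agree_upto_trunc n f : agree_upto n f (\poly_(i < n.+1) f i).
Proof. by move=> i le_in; rewrite coef_poly ltnS le_in. Qed.

Lemma agree_uptoM n f g p r :
  agree_upto n f p -> agree_upto n g r -> agree_upto n (fps_mul f g) (p * r).
Proof.
move=> fp gr i le_in; rewrite coefM; apply: eq_bigr => j _.
by rewrite fp ?gr // (leq_trans _ le_in) ?leq_subr // -ltnS.
Qed.

Fact fps_mulA : associative (@fps_mul R).
Proof.
move=> f g h; apply/funext => n; have tr k := @agree_upto_trunc n k.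
rewrite (agree_uptoM (tr f) (agree_uptoM (tr g) (tr h)) (leqnn n)) mulrA.
by rewrite (agree_uptoM (agree_uptoM (tr f) (tr g)) (tr h) (leqnn n)).
Qed.

Fact fps_mulC : commutative (@fps_mul R).
Proof.
move=> f g; apply/funext => n; have tr k := @agree_upto_trunc n k.
by rewrite (agree_uptoM (tr f) (tr g) (leqnn n)) mulrC
           (agree_uptoM (tr g) (tr f) (leqnn n)).
Qed.

Fact fps_mul1 : left_id (fps_poly 1) (@fps_mul R).
Proof.
move=> f; apply/funext => n.
have one : agree_upto n (fps_poly (1 : {poly R})) 1 by [].
rewrite (agree_uptoM one (@agree_upto_trunc n f) (leqnn n)) mul1r.
by rewrite -agree_upto_trunc.
Qed.

Fact fps_mulD : left_distributive (@fps_mul R) +%R.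
Proof.
move=> f g h; apply/funext => n; rewrite /fps_mul /GRing.add /= /fps_add -big_split.
by apply: eq_bigr => i _; rewrite /= mulrDl.
Qed.

Fact fps_one_neq0 : fps_poly (1 : {poly R}) != 0.
Proof.
apply/eqP=> /(congr1 (fun f : fps R => f 0%N)) /eqP.
by rewrite /fps_poly coef1 /GRing.zero /= /fps_poly coef0 oner_eq0.
Qed.

HB.instance Definition _ := GRing.Zmodule_isComNzRing.Build (fps R)
  fps_mulA fps_mulC fps_mul1 fps_mulD fps_one_neq0.

Lemma fps_coef0 n : (0 : fps R) n = 0.
Proof. exact: coef0. Qed.

Lemma fps_coef1 n : (1 : fps R) n = (n == 0%N)%:R.
Proof. exact: coef1. Qed.

Lemma fps_coefD f g n : (f + g) n = f n + g n.
Proof. by []. Qed.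

Lemma fps_coefN f n : (- f) n = - f n.
Proof. by []. Qed.

Lemma fps_coefM f g n : (f * g) n = \sum_(i < n.+1) f i * g (n - i)%N.
Proof. by []. Qed.

Lemma fps_coef_sum I (r : seq I) (P : pred I) (F : I -> fps R) n :
  (\sum_(i <- r | P i) F i) n = \sum_(i <- r | P i) F i n.
Proof.
by elim/big_rec2: _ => [|i x y _ <-]; rewrite ?fps_coef0 ?fps_coefD.
Qed.

Lemma fps_polyD (p r : {poly R}) : fps_poly (p + r) = fps_poly p + fps_poly r.
Proof. by apply/funext => n; rewrite fps_coefD /fps_poly coefD. Qed.

Lemma fps_polyM (p r : {poly R}) : fps_poly (p * r) = fps_poly p * fps_poly r.
Proof. by apply/funext => n; rewrite fps_coefM /fps_poly coefM. Qed.

Lemma fps_polyX (p : {poly R}) n : fps_poly (p ^+ n) = fps_poly p ^+ n.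
Proof. by elim: n => [|n IHn] //; rewrite !exprS fps_polyM IHn. Qed.

Definition fpsX : fps R := fps_poly 'X.

Lemma fps_coefXnM k f n : (fpsX ^+ k * f) n = if (n < k)%N then 0 else f (n - k)%N.
Proof.
have Xk : agree_upto n (fpsX ^+ k) 'X^k by move=> i _; rewrite -fps_polyX.
rewrite [LHS](agree_uptoM Xk (@agree_upto_trunc n f) (leqnn n)) coefXnM.
by case: ltnP => // le_kn; rewrite -agree_upto_trunc ?leq_subr.
Qed.

Lemma fps_coefXM f n : (fpsX * f) n = if n is n'.+1 then f n' else 0.
Proof. by rewrite -[fpsX]expr1 fps_coefXnM; case: n => // n; rewrite subn1. Qed.

Lemma fps_mulrV f : f 0%N = 1 -> f * fps_inv f = 1.
Proof. by move=> f0; apply/funext; apply: fps_mulV. Qed.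

End FpsRing.

(** * The finite triple product *)

Section FiniteTripleProduct.
Variable A : comNzRingType.
Variable q : A.

(** Gaussian binomials, built by the q-Pascal rule to avoid division in [A]. *)
Fixpoint gauss (n k : nat) : A :=
  match n, k with
  | _, 0 => 1
  | 0, _.+1 => 0
  | n'.+1, k'.+1 => gauss n' k' + q ^+ k'.+1 * gauss n' k'.+1
  end.

Lemma gauss0 n : gauss n 0 = 1.
Proof. by case: n. Qed.

Lemma gaussS n k : gauss n.+1 k.+1 = gauss n k + q ^+ k.+1 * gauss n k.+1.
Proof. by []. Qed.

Lemma gauss_small n k : (n < k)%N -> gauss n k = 0.
Proof.
elim: n k => [|n IHn] [|k] //= lt_nk.
by rewrite !IHn ?mulr0 ?addr0 // ltnW.
Qed.

Lemma gauss_diag n : gauss n n = 1.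
Proof. by elim: n => //= n ->; rewrite gauss_small // mulr0 addr0. Qed.

Local Arguments gauss : simpl never.

(** The mirror q-Pascal rule, proved before symmetry is available: [gaussS] and induction reduce
    both sides to entries of row [n]. *)
Lemma gaussS' n k : gauss n.+1 k.+1 = q ^+ (n - k) * gauss n k + gauss n k.+1.
Proof.
elim: n k => [|n IHn] [|k] //; try by rewrite /gauss /= ?mul1r ?mulr0 ?addr0.
  rewrite gaussS [in LHS]IHn [in RHS]gaussS !gauss0 !subn0 !exprS; ring.
rewrite [LHS]gaussS.
rewrite [in LHS](IHn k) [in LHS](IHn k.+1) [in RHS](gaussS n k) [in RHS](gaussS n k.+1) subSS.
case: (ltnP n k.+1) => [lt_nk|lt_kn].
  rewrite ?(gauss_small lt_nk) ?(@gauss_small n k.+2) ; [ring | lia].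
have -> : (n - k = (n - k.+1).+1)%N by lia.
by rewrite !exprS; ring.
Qed.

Lemma gauss_sym n k : (k <= n)%N -> gauss n (n - k) = gauss n k.
Proof.
elim: n k => [|n IHn] [|k] //; rewrite ?subn0 ?gauss_diag ?gauss0 // ltnS subSS => le_kn.
move: (le_kn); rewrite leq_eqVlt => /predU1P[->|lt_kn].
  by rewrite subnn gauss0 gauss_diag.
have -> : (n - k = (n - k.+1).+1)%N by lia.
rewrite gaussS' IHn // subKn // gaussS addrC; congr (_ + _).
by rewrite -(IHn k) //; congr (gauss _ _); lia.
Qed.

(** Both Pascal rules combined; this carries row 2n+1 to row 2n+3 in the triple product. *)
Lemma gaussSS n k :
  gauss n.+2 k.+1 = (1 + q ^+ n.+1) * gauss n k + q ^+ k.+1 * gauss n k.+1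
    + (if k is k'.+1 then q ^+ (n - k') * gauss n k' else 0).
Proof.
rewrite gaussS gaussS'; case: k => [|k].
  by rewrite !gauss0 subn0 !exprS; ring.
rewrite [gauss n.+1 k.+1]gaussS'.
case: (ltnP n k.+1) => [lt_nk|lt_kn].
  rewrite ?(gauss_small lt_nk) ?(@gauss_small n k.+2) ; [ring | lia].
have -> : q ^+ n.+1 = q ^+ k.+2 * q ^+ (n - k.+1).
  by rewrite -exprD; congr (_ ^+ _); lia.
ring.
Qed.

(** Expanded by opposite Pascal rules, both entries contain [n-1, k]; the leftovers carry q^(k+1)
    and q^(n-k), and n-k >= k+1. *)
Lemma gauss_step n k : (k.*2 < n)%N ->
  exists h, gauss n k.+1 = gauss n k + q ^+ k.+1 * h.
Proof.
case: n => // n lt_kn; rewrite gaussS; case: k lt_kn => [|k] lt_kn.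
  by exists (gauss n 1); rewrite !gauss0.
exists (gauss n k.+2 - q ^+ (n - k - k.+2) * gauss n k).
rewrite gaussS'.
have {1}-> : (n - k = k.+2 + (n - k - k.+2))%N by lia.
by rewrite exprD; ring.
Qed.

(** With x = z + 1/z - 2 this is (z^m + z^(-m-1)) / (1 + 1/z), while (1 + q^k)^2 + x q^k = (1 + z
    q^k)(1 + q^k/z): the triple product with its terms m and -m-1 paired. *)
Definition bin_poly m : {poly A} := \poly_(k < m.+1) ('C(m + k, k.*2))%:R.

Lemma coef_bin_poly m k : (bin_poly m)`_k = ('C(m + k, k.*2))%:R.
Proof. by rewrite coef_poly; case: ltnP => // lt_mk; rewrite bin_small //; lia. Qed.

Lemma bin_polySS m :
  bin_poly m.+2 = (2%:R + 'X) * bin_poly m.+1 - bin_poly m.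
Proof.
apply/polyP=> k; rewrite coefB mulrDl coefD coefXM mulr_natl coefMn 2!coef_bin_poly.
case: k => [|k] /=.
  by rewrite coef_bin_poly !addn0 !bin0 addr0; ring.
rewrite !coef_bin_poly !addSn !addnS !doubleS; set n := (m + k)%N; set j := k.*2.
apply: (canRL (addrK _)).
rewrite -mulrnA -!natrD; congr _%:R.
rewrite (binS n.+2 j.+1) (binS n.+1 j.+1) (binS n.+1 j); lia.
Qed.

Definition triple_coef n m : A := if (m <= n)%N then gauss n.*2.+1 (n - m) else 0.

Lemma triple_coefS0 n :
  triple_coef n.+1 0 = (1 + q ^+ n.+1 + q ^+ n.*2.+2) * triple_coef n 0
     + q ^+ n.+2 * triple_coef n 1.
Proof.
rewrite /triple_coef /= !subn0 doubleS gaussSS.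
have -> : gauss n.*2.+1 n.+1 = gauss n.*2.+1 n.
  rewrite -[RHS]gauss_sym; first by congr gauss; lia.
  lia.
case: n => [|n] /=; first by ring.
have -> : ((n.+1).*2.+1 - n = n.+3)%N by lia.
by rewrite subSS subn0; ring.
Qed.

(** The factor q^(m+1) is q^(T(m+1) - T m): weighting by q^(T m) turns this into the three-term
    recurrence with coefficients Q, 1 + Q^2, Q, where Q = q^(n+1). *)
Lemma triple_coefSS n m :
  triple_coef n.+1 m.+1 * q ^+ m.+1 = (1 + q ^+ n.*2.+2) * triple_coef n m.+1 * q ^+ m.+1
     + q ^+ n.+1 * triple_coef n m + q ^+ (n + m + m.+4) * triple_coef n m.+2.
Proof.
rewrite /triple_coef ltnS subSS doubleS.
case: (ltngtP m n) => [lt_mn|lt_nm|->]; last first.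
- by rewrite subnn !gauss0 ?ifF; try lia; ring.
- by rewrite ?ifF; try lia; ring.
have -> : (n - m = (n - m.+1).+1)%N by lia.
rewrite gaussSS; set k := (n - m.+1)%N.
have -> : q ^+ n.+1 = q ^+ k.+1 * q ^+ m.+1.
  by rewrite -exprD; congr (_ ^+ _); lia.
case: ltnP => [lt_m1n|le_nm1].
  have -> : (n - m.+2 = k.-1)%N by lia.
  case Dk: k => [|k'] /=; first by lia.
  have -> : (n + m + m.+4 = n.*2.+1 - k' + m.+1)%N by lia.
  by rewrite exprD !exprS; ring.
have -> : k = 0%N by lia.
rewrite !exprS; ring.
Qed.

(** Induction on [n]: by [bin_polySS], multiplying [bin_poly] by the new factor produces the same
    three-term pattern as the recurrence of the weighted coefficients. *)
Lemma finite_triple_product n :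
  \prod_(k < n) (((1 + q ^+ k.+1) ^+ 2)%:P + q ^+ k.+1 *: 'X) =
  \sum_(m < n.+1) (triple_coef n m * q ^+ 'C(m.+1, 2)) *: bin_poly m.
Proof.
elim: n => [|n IHn].
  rewrite big_ord0 big_ord1 /triple_coef /= !mul1r scale1r.
  apply/polyP=> -[|k]; rewrite coef1 coef_bin_poly //=.
  by rewrite bin_small //; lia.
rewrite big_ord_recr IHn /= mulr_suml.
pose c m := triple_coef n m * q ^+ 'C(m.+1, 2).
have c0 m : (n < m)%N -> c m = 0.
  by move=> lt_nm; rewrite /c /triple_coef leqNgt lt_nm mul0r.
pose d := 1 + q ^+ n.*2.+2.
pose Q := q ^+ n.+1.
have T m : 'C(m.+2, 2) = ('C(m.+1, 2) + m.+1)%N by rewrite binS bin1.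
have c'0 : triple_coef n.+1 0 * q ^+ 'C(1, 2) = d * c 0%N + Q * c 0%N + Q * c 1%N.
  by rewrite /c triple_coefS0 T bin_small // /d /Q !exprS; ring.
have c'S m : triple_coef n.+1 m.+1 * q ^+ 'C(m.+2, 2)
    = d * c m.+1 + Q * c m + Q * c m.+2.
  rewrite /c T exprD exprS.
  transitivity (triple_coef n.+1 m.+1 * q ^+ m.+1 * q ^+ 'C(m.+1, 2)).
    by rewrite exprS; ring.
  rewrite triple_coefSS !T /d /Q !exprD !exprS; ring.
(* At the boundary, [bin_poly 0] stands in for index -1, by the reflection of m into -m-1. *)
have X0 : (((1 + Q) ^+ 2)%:P + Q *: 'X) * bin_poly 0 =
   d *: bin_poly 0 + Q *: bin_poly 0 + Q *: bin_poly 1.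
  have -> : bin_poly 1 = 'X + 1.
    apply/polyP=> -[|[|k]]; rewrite coef_bin_poly coefD coefX coef1 //=.
    - by rewrite add0r.
    - by rewrite addr0.
    by rewrite bin_small ?addr0 //; lia.
  have -> : bin_poly 0 = 1.
    by apply/polyP=> -[|k]; rewrite coef_bin_poly coef1 //= bin_small //; lia.
  rewrite /d -!mul_polyC !polyCD.
  have -> : q ^+ n.*2.+2 = Q ^+ 2 by rewrite /Q -exprM; congr (_ ^+ _); lia.
  rewrite !expr2 !polyCM !polyCD polyC1; ring.
have XS m : (((1 + Q) ^+ 2)%:P + Q *: 'X) * bin_poly m.+1 =
   d *: bin_poly m.+1 + Q *: bin_poly m + Q *: bin_poly m.+2.
  rewrite bin_polySS /d -!mul_polyC !polyCD.
  have -> : q ^+ n.*2.+2 = Q ^+ 2 by rewrite /Q -exprM; congr (_ ^+ _); lia.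
  rewrite !expr2 !polyCM !polyCD polyC1; ring.
have recl (F : nat -> {poly A}) k : \sum_(i < k.+1) F i = F 0%N + \sum_(i < k) F i.+1.
  exact: big_ord_recl.
have recr (F : nat -> {poly A}) k : \sum_(i < k.+1) F i = \sum_(i < k) F i + F k.
  exact: big_ord_recr.
rewrite [RHS](recl (fun m => (triple_coef n.+1 m * q ^+ 'C(m.+1, 2)) *: bin_poly m)) c'0.
under [in RHS]eq_bigr => i _ do rewrite c'S.
set W := _%:P + _ in X0 XS *.
have cE m : triple_coef n m * q ^+ 'C(m.+1, 2) = c m by [].
clearbody c d W Q.
(* Common form of both sides: the diagonal part, the shift down with its boundary term, and the
   shift up. *)
transitivity (d *: (\sum_(i < n.+1) c i *: bin_poly i)
  + Q *: (c 0%N *: bin_poly 0 + \sum_(i < n) c i.+1 *: bin_poly i)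
  + Q *: (\sum_(i < n.+1) c i *: bin_poly i.+1)).
  transitivity (\sum_(m < n.+1) c m *: (W * bin_poly m)).
    by apply: eq_bigr => m _; rewrite -scalerAl [_ * W]mulrC cE.
  rewrite (recl (fun m => c m *: (W * bin_poly m))) (recl (fun m => c m *: bin_poly m)) X0.
  rewrite (recl (fun m => c m *: bin_poly m.+1)).
  under eq_bigr => i _ do rewrite XS !scalerDr.
  rewrite !big_split /= !scalerDr !scaler_sumr.
  have swap e (P : nat -> {poly A}) :
      \sum_(i < n) c i.+1 *: (e *: P i) = \sum_(i < n) e *: (c i.+1 *: P i).
    by apply: eq_bigr => i _; rewrite !scalerA mulrC.
  rewrite (swap d (fun i => bin_poly i.+1)) (swap Q bin_poly) (swap Q (fun i => bin_poly i.+2)).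
  by rewrite !scalerA ![c 0%N * _]mulrC; ring.
under [in RHS]eq_bigr => i _ do rewrite 2!scalerDl -!scalerA.
rewrite !big_split /= !scalerDl -!scaler_sumr -!scalerA.
have last0 f (P : nat -> {poly A}) k : f k = 0 ->
    \sum_(i < k.+1) f i *: P i = \sum_(i < k) f i *: P i.
  by move=> fk; rewrite (recr (fun i => f i *: P i)) fk scale0r addr0.
have -> : \sum_(i < n.+1) c i.+2 *: bin_poly i.+1 =
    \sum_(i < n) c i.+1 *: bin_poly i - c 1%N *: bin_poly 0.
  apply: (canRL (addrK _)); rewrite addrC -(recl (fun i => c i.+1 *: bin_poly i)).
  by rewrite 2?(last0 (fun i => c i.+1) bin_poly) // c0.
have -> : \sum_(i < n.+1) c i.+1 *: bin_poly i.+1 =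
    \sum_(i < n.+1) c i *: bin_poly i - c 0%N *: bin_poly 0.
  apply: (canRL (addrK _)); rewrite addrC -(recl (fun i => c i *: bin_poly i)).
  by rewrite (last0 c bin_poly) // c0.
rewrite !scalerDr !scalerN; ring.
Qed.

(** * Elementary symmetric functions and comparison modulo q^(n+1) *)

Definition elsym n t (y : 'I_n -> A) : A :=
  \sum_(B : {set 'I_n} | #|B| == t) \prod_(i in B) y i.

Lemma coef_prod_elsym n t (y : 'I_n -> A) :
  (\prod_(i < n) (1 + y i *: 'X))`_t = elsym t y.
Proof.
under eq_bigr => i _ do rewrite addrC -mul_polyC.
rewrite bigA_distr coef_sum /elsym [RHS]big_mkcond.
apply: eq_big => [B|B _]; first by rewrite inE.
rewrite -big_mkcond big_split /= prodr_const -rmorph_prod coefCM coefXn eq_sym.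
by case: eqP; rewrite ?mulr1 ?mulr0.
Qed.

(** Compares coefficients of x^t after pulling (1 + q^k)^2 out of each factor; [y] is q^k / (1 +
    q^k)^2, given by an equation since [A] need not have inverses. *)
Lemma triple_coef_elsym n t (y : 'I_n -> A) :
    (forall i : 'I_n, (1 + q ^+ i.+1) ^+ 2 * y i = q ^+ i.+1) ->
  \prod_(i < n) (1 + q ^+ i.+1) ^+ 2 * elsym t y =
  \sum_(m < n.+1) triple_coef n m * q ^+ 'C(m.+1, 2) * ('C(m + t, t.*2))%:R.
Proof.
move=> yP; have /(congr1 (fun p : {poly A} => p`_t)) := finite_triple_product n.
rewrite coef_sum; under [in RHS]eq_bigr => m _ do rewrite coefZ coef_bin_poly.
move=> <-; rewrite -coef_prod_elsym -coefCM rmorph_prod -big_split /=.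
have E (i : 'I_n) : ((1 + q ^+ i.+1) ^+ 2)%:P * (1 + y i *: 'X)
    = ((1 + q ^+ i.+1) ^+ 2)%:P + q ^+ i.+1 *: 'X.
  by rewrite mulrDr mulr1 -scalerAr mul_polyC scalerA [y i * _]mulrC yP.
by under eq_bigr => i _ do rewrite E.
Qed.

Lemma gauss_central n k : (k <= n)%N ->
  exists h, gauss n.*2.+1 k = gauss n.*2.+1 n + q ^+ k.+1 * h.
Proof.
move=> le_kn; rewrite -(subKn le_kn); elim: (n - k)%N (leq_subr k n) => [|d IHd] le_dn.
  by exists 0; rewrite subn0 mulr0 addr0.
have [h] := IHd (ltnW le_dn); have -> : (n - d = (n - d.+1).+1)%N by lia.
have [|h' ->] := @gauss_step n.*2.+1 (n - d.+1); first by lia.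
move=> /(canRL (addrK _)) ->; exists (q * h - h').
by rewrite !exprS; ring.
Qed.

(** [gauss_central] leaves an error q^(n-m+1); since T m >= m, the weight supplies the missing
    q^m. *)
Lemma triple_coef_central n m : (m <= n)%N ->
  exists h, triple_coef n m * q ^+ 'C(m.+1, 2)
    = gauss n.*2.+1 n * q ^+ 'C(m.+1, 2) + q ^+ n.+1 * h.
Proof.
move=> le_mn; rewrite /triple_coef le_mn.
have [|h ->] := @gauss_central n (n - m); first exact: leq_subr.
exists (q ^+ ('C(m.+1, 2) - m) * h).
have le_mT : (m <= 'C(m.+1, 2))%N by rewrite binS bin1 leq_addl.
have E : q ^+ 'C(m.+1, 2) = q ^+ ('C(m.+1, 2) - m) * q ^+ m.
  by rewrite -exprD subnK.
have -> : q ^+ n.+1 = q ^+ (n - m).+1 * q ^+ m.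
  by rewrite -exprD; congr (_ ^+ _); lia.
by rewrite mulrDl [in X in _ + X]E; ring.
Qed.

Lemma triple_coef_sum_central n (w : nat -> A) : exists h,
  \sum_(m < n.+1) triple_coef n m * q ^+ 'C(m.+1, 2) * w m =
  gauss n.*2.+1 n * (\sum_(m < n.+1) q ^+ 'C(m.+1, 2) * w m) + q ^+ n.+1 * h.
Proof.
elim/big_ind2: _ => [|x1 x2 y1 y2 [h1 ->] [h2 ->]|m _].
- by exists 0; rewrite !mulr0 addr0.
- by exists (h1 + h2); ring.
have [|h ->] := @triple_coef_central n m; first by rewrite -ltnS.
by exists (h * w m); ring.
Qed.

(** Case 0 of [triple_coef_elsym] evaluates the product itself; multiplied by [elsym t y] and
    compared with case t, it eliminates the product. *)
Lemma elsym_mod n t (y : 'I_n -> A) :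
    (forall i : 'I_n, (1 + q ^+ i.+1) ^+ 2 * y i = q ^+ i.+1) ->
  exists h, gauss n.*2.+1 n * ((\sum_(m < n.+1) q ^+ 'C(m.+1, 2)) * elsym t y
    - \sum_(m < n.+1) q ^+ 'C(m.+1, 2) * ('C(m + t, t.*2))%:R) = q ^+ n.+1 * h.
Proof.
move=> yP; have /esym := triple_coef_elsym t yP.
have := triple_coef_elsym 0 yP; rewrite {1}/elsym (bigD1 set0) ?cards0 //=.
rewrite big_set0 [X in 1 + X]big1 ?addr0 => [|B /andP[/eqP/cards0_eq-> /eqP]] //.
have [h ->] := triple_coef_sum_central n (fun m => 'C(m + t, t.*2)%:R).
have [h0 ->] := triple_coef_sum_central n (fun m => 'C(m + 0, 0.*2)%:R).
have -> : \sum_(m < n.+1) q ^+ 'C(m.+1, 2) * ('C(m + 0, 0.*2))%:R =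
    \sum_(m < n.+1) q ^+ 'C(m.+1, 2).
  by apply: eq_bigr => m _; rewrite bin0 mulr1.
rewrite mulr1 => -> E; exists (h - h0 * elsym t y).
set g := gauss _ _ in E *; set St := \sum_(m < _) _ in E *; set S0 := \sum_(m < _) _ in E *.
transitivity ((g * S0 + q ^+ n.+1 * h0) * elsym t y - (g * St + q ^+ n.+1 * h)
  + q ^+ n.+1 * (h - h0 * elsym t y)); first by ring.
by rewrite E subrr add0r.
Qed.

End FiniteTripleProduct.

(** * The generating function of MO(2,t;n) *)

Section TriangularSeries.
Variable R : comNzRingType.

(** The series of w(k) q^(T k); bounding [k] by [n] loses nothing because k <= T k. *)
Definition tri_series (w : nat -> R) : fps R :=
  fun n => \sum_(k < n.+1 | 'C(k.+1, 2) == n) w k.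

Definition psi : fps R := tri_series (fun=> 1).

Lemma leq_triangular k : (k <= 'C(k.+1, 2))%N.
Proof. by rewrite binS bin1 leq_addl. Qed.

Lemma psi_coef0 : psi 0 = 1.
Proof. by rewrite /psi /tri_series big_mkcond big_ord1. Qed.

Lemma fps_coef_natM (m : nat) (f : fps R) n : (f * m%:R) n = f n * m%:R.
Proof.
rewrite !mulr_natr; elim: m => [|m IHm]; first by rewrite !mulr0n fps_coef0.
by rewrite !mulrSr fps_coefD IHm.
Qed.

Lemma tri_series_trunc (w : nat -> nat) N n : (n <= N)%N ->
  (\sum_(m < N.+1) fpsX R ^+ 'C(m.+1, 2) * (w m)%:R) n =
  tri_series (fun m => (w m)%:R) n.
Proof.
move=> le_nN; rewrite fps_coef_sum /tri_series.
have coefX m : (fpsX R ^+ 'C(m.+1, 2) * (w m)%:R) n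
    = if 'C(m.+1, 2) == n then (w m)%:R else 0.
  rewrite fps_coef_natM -[_ ^+ _]mulr1 fps_coefXnM fps_coef1 subn_eq0.
  by case: ltngtP; rewrite ?mul0r ?mul1r.
rewrite (big_ord_widen_cond N.+1 (fun k => 'C(k.+1, 2) == n) (fun k => (w k)%:R)) //.
rewrite [RHS]big_mkcond; apply: eq_bigr => m _; rewrite coefX.
case: eqP => //= Tm; rewrite ifT // ltnS -Tm; exact: leq_triangular.
Qed.

End TriangularSeries.

Lemma gauss_coef0 (R : comNzRingType) n k :
  (k <= n)%N -> gauss (fpsX R) n k 0%N = 1.
Proof.
elim: n k => [|n IHn] [|k] //; rewrite ?gauss0 ?fps_coef1 // ltnS => le_kn.
by rewrite gaussS fps_coefD fps_coefXnM addr0 IHn.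
Qed.

Lemma fps_poly_MO_den2 m : fps_poly (MO_den 2 m) = (1 + fpsX int ^+ m) ^+ 2.
Proof.
rewrite /MO_den -mul_polyC !fps_polyD fps_polyM mulnC exprM !fps_polyX.
have -> : fps_poly (2%:P : {poly int}) = 2.
  by rewrite -[2]/(1 + 1)%R polyCD fps_polyD.
rewrite -[fps_poly 1]/(1 : fps int) -/(fpsX int); ring.
Qed.

Lemma MO_term2 K (B : {set 'I_K}) : MO_term 2 B =
  \prod_(i in B) (fpsX int ^+ i.+1 * fps_inv (fps_poly (MO_den 2 i.+1))).
Proof.
rewrite /MO_term fps_polyX big_split; congr (_ * _).
by elim/big_rec2: _ => [|i m f _ <-] //=; rewrite exprD.
Qed.

Lemma MO_partial2 t K : MO_partial 2 t K =
  elsym t (fun i : 'I_K => fpsX int ^+ i.+1 * fps_inv (fps_poly (MO_den 2 i.+1))).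
Proof.
apply/funext => n; rewrite /MO_partial /elsym fps_coef_sum.
by apply: eq_bigr => B _; rewrite MO_term2.
Qed.

(** [elsym_mod] at level [n] settles coefficient [n]: the central Gaussian binomial has constant
    term 1 and cancels, and a multiple of q^(n+1) does not reach degree [n]. *)
Theorem psi_MO2 t :
  psi int * (MO 2 t : fps int) = tri_series (fun m => ('C(m + t, t.*2))%:R).
Proof.
apply/funext => n.
have [i|h] := @elsym_mod _ (fpsX int) n t
  (fun i : 'I_n => fpsX int ^+ i.+1 * fps_inv (fps_poly (MO_den 2 i.+1))).
  by rewrite mulrCA -fps_poly_MO_den2 fps_mulrV ?mulr1 // MO_den0.
rewrite -MO_partial2; set g := gauss _ _ _.
have g0 : g 0%N = 1 by rewrite /g gauss_coef0 //; lia.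
move=> /(congr1 (fun f => fps_inv g * f)).
rewrite mulrA [_ * g]mulrC fps_mulrV // mul1r mulrCA.
move=> /(congr1 (fun f : fps int => f n)).
rewrite fps_coefXnM ltnSn fps_coefD fps_coefN (tri_series_trunc _ (fun m => 'C(m + t, t.*2))) //.
move=> /eqP; rewrite subr_eq0 => /eqP <-; rewrite !fps_coefM.
apply: eq_bigr => i _; rewrite MO_partial_stable ?leq_subr //; congr (_ * _).
rewrite -[psi int i](@tri_series_trunc int (fun=> 1%N) n i) -1?ltnS //.
by under eq_bigr => m _ do rewrite mulr1.
Qed.

(** * 5-dissections *)

Section Dissection.
Variable R : comNzRingType.
Implicit Types f g : fps R.

Definition dissect r f : fps R := fun n => f (5 * n + r)%N.

Definition dilate f : fps R := fun n => if (5 %| n)%N then f (n %/ 5)%N else 0.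

Lemma dissectD r f g : dissect r (f + g) = dissect r f + dissect r g.
Proof. by []. Qed.

Lemma dissectN r f : dissect r (- f) = - dissect r f.
Proof. by []. Qed.

(** Residues s and r - s add up to r modulo 5; when s > r the addition carries, hence the factor
    q. *)
Lemma dissectM r f g : (r < 5)%N ->
  dissect r (f * g) = \sum_(s < 5)
    if (s <= r)%N then dissect s f * dissect (r - s) g
    else fpsX R * (dissect s f * dissect (5 + r - s) g).
Proof.
move=> lt_r5; apply/funext => n; rewrite fps_coef_sum /dissect fps_coefM.
(* Padding by zeros gives n+1 full blocks of five; for s > r the last block only contributes
   padding. *)
pose F i := if (i <= 5 * n + r)%N then f i * g (5 * n + r - i)%N else 0.
transitivity (\sum_(0 <= i < n.+1 * 5) F i).
  rewrite big_mkord (big_ord_widen (n.+1 * 5) (fun i => f i * g (5 * n + r - i)%N)); last lia.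
  by rewrite big_mkcond; apply: eq_bigr => i _; rewrite ltnS.
rewrite big_nat_mul; transitivity (\sum_(0 <= k < n.+1) \sum_(s < 5) F (5 * k + s)%N).
  apply: eq_bigr => k _; rewrite mulSn -[in RHS](big_mkord predT (fun s => F (5 * k + s)%N)).
  rewrite -{1}[(k * 5)%N]add0n big_addn addnK; apply: eq_bigr => s _; congr F; lia.
rewrite exchange_big; apply: eq_bigr => s _ /=; rewrite big_mkord; case: leqP => [le_sr|lt_rs].
  apply: eq_bigr => k _; rewrite /F ifT; last by have := ltn_ord k; lia.
  by congr (_ * g _); have := ltn_ord k; lia.
rewrite big_ord_recr /= [F _]ifF ?addr0; last lia.
rewrite fps_coefXM; case: n @F => [|n] F; first by rewrite big_ord0.
apply: eq_bigr => k _; rewrite /F ifT; last by have := ltn_ord k; have := ltn_ord s; lia.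
by congr (_ * g _); have := ltn_ord k; have := ltn_ord s; lia.
Qed.

Lemma dissect_dilate0 f : dissect 0 (dilate f) = f.
Proof. by apply/funext => n; rewrite /dissect /dilate addn0 dvdn_mulr // mulKn. Qed.

Lemma dissect_dilate r f : (0 < r < 5)%N -> dissect r (dilate f) = 0.
Proof.
by move=> r_range; apply/funext => n; rewrite /dissect /dilate fps_coef0 ifF //; lia.
Qed.

Lemma dissect0M f g : dissect 0 (f * g) =
  dissect 0 f * dissect 0 g
  + fpsX R * (dissect 1 f * dissect 4 g + dissect 2 f * dissect 3 g
    + dissect 3 f * dissect 2 g + dissect 4 f * dissect 1 g).
Proof. by rewrite dissectM // !big_ord_recl big_ord0 /bump /= ?addnE /=; ring. Qed.

Lemma dissect1M f g : dissect 1 (f * g) =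
  dissect 0 f * dissect 1 g + dissect 1 f * dissect 0 g
  + fpsX R * (dissect 2 f * dissect 4 g + dissect 3 f * dissect 3 g
    + dissect 4 f * dissect 2 g).
Proof. by rewrite dissectM // !big_ord_recl big_ord0 /bump /= ?addnE /=; ring. Qed.

Lemma dissect2M f g : dissect 2 (f * g) =
  dissect 0 f * dissect 2 g + dissect 1 f * dissect 1 g + dissect 2 f * dissect 0 g
  + fpsX R * (dissect 3 f * dissect 4 g + dissect 4 f * dissect 3 g).
Proof. by rewrite dissectM // !big_ord_recl big_ord0 /bump /= ?addnE /=; ring. Qed.

Lemma dissect3M f g : dissect 3 (f * g) =
  dissect 0 f * dissect 3 g + dissect 1 f * dissect 2 g
    + dissect 2 f * dissect 1 g + dissect 3 f * dissect 0 g
  + fpsX R * (dissect 4 f * dissect 4 g).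
Proof. by rewrite dissectM // !big_ord_recl big_ord0 /bump /= ?addnE /=; ring. Qed.

Lemma dissect4M f g : dissect 4 (f * g) =
  dissect 0 f * dissect 4 g + dissect 1 f * dissect 3 g
    + dissect 2 f * dissect 2 g + dissect 3 f * dissect 1 g + dissect 4 f * dissect 0 g.
Proof. by rewrite dissectM // !big_ord_recl big_ord0 /bump /= ?addnE /=; ring. Qed.

Definition dissect_mul := (dissect0M, dissect1M, dissect2M, dissect3M, dissect4M).

End Dissection.

(** * Theta series and sums of two triangular numbers *)

Lemma tri_series_widen (R : comNzRingType) (w : nat -> R) n N : (n <= N)%N ->
  tri_series w n = \sum_(k < N.+1 | 'C(k.+1, 2) == n) w k.
Proof.
move=> le_nN; rewrite /tri_series.
rewrite (big_ord_widen_cond N.+1 (fun k => 'C(k.+1, 2) == n)) //.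
apply: eq_bigl => k; rewrite andb_idr // => /eqP <-; rewrite ltnS; exact: leq_triangular.
Qed.

(** T extended to all integers: [Negz k] is -1-k, and T(-1-k) = T k. *)
Definition tri (x : int) : nat :=
  match x with Posz k | Negz k => 'C(k.+1, 2) end.

Lemma triP (x : int) : 2 * (tri x)%:Z = x * (x + 1).
Proof.
by case: x => k /=; have := mul_bin_diag k.+1 1; rewrite bin1 /= ?NegzE; lia.
Qed.

Definition int_range n : seq int :=
  [seq Posz k | k <- iota 0 n.+1] ++ [seq Negz k | k <- iota 0 n.+1].

Lemma mem_int_range n x : (tri x <= n)%N -> x \in int_range n.
Proof.
rewrite mem_cat; case: x => k le_kn; apply/orP; [left | right];
  by apply/mapP; exists k => //; rewrite mem_iota ltnS (leq_trans (leq_triangular k)).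
Qed.

Lemma uniq_int_range n : uniq (int_range n).
Proof.
rewrite cat_uniq !map_inj_uniq ?iota_uniq; try by move=> ? ? [].
by rewrite andbT; apply/hasPn => _ /mapP[k _ ->]; apply/mapP => -[].
Qed.

Definition int_box n := [seq (x, y) | x <- int_range n, y <- int_range n].

Lemma mem_int_box n x y : (tri x + tri y <= n)%N -> (x, y) \in int_box n.
Proof. by move=> le_n; rewrite allpairs_f ?mem_int_range //; lia. Qed.

Lemma uniq_int_box n : uniq (int_box n).
Proof. by apply: allpairs_uniq; rewrite ?uniq_int_range // => -[? ?] [? ?]. Qed.

Lemma leq_count (T1 T2 : eqType) (f : T1 -> T2) (P1 : pred T1) (P2 : pred T2)
    (s1 : seq T1) (s2 : seq T2) :
    uniq s1 -> (forall z, P1 z -> P2 (f z) /\ f z \in s2) ->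
    (forall z z', P1 z -> P1 z' -> f z = f z' -> z = z') ->
  (count P1 s1 <= count P2 s2)%N.
Proof.
move=> s1_uniq fP f_inj; rewrite -!size_filter -(size_map f).
apply: uniq_leq_size.
  rewrite map_inj_in_uniq ?filter_uniq // => z z'.
  by rewrite !mem_filter => /andP[Pz _] /andP[Pz' _]; apply: f_inj.
move=> y /mapP[z]; rewrite mem_filter => /andP[/fP[Pz s2z] _] ->.
by rewrite mem_filter Pz.
Qed.

(* Multiplication by 2 + i on the points (2 x + 1) + i (2 y + 1). *)
Lemma count_box n :
  count (fun z : int * int => ((2 * z.1 + z.2) %% 5 == 1)%Z
     && (tri z.1 + tri z.2 == 5 * n + 1)%N) (int_box (5 * n + 1)) =
  count (fun z : int * int => (tri z.1 + tri z.2 == n)%N) (int_box n).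
Proof.
apply/eqP; rewrite eqn_leq; apply/andP; split.
  (* Division by 2 + i: the congruence says that it is possible, and the two integer quotients then
     have remainders 1 and 2. *)
  apply: (@leq_count _ _ (fun z => ((2 * z.1 + z.2) %/ 5, (2 * z.2 - z.1) %/ 5))%Z).
  - exact: uniq_int_box.
  - move=> [x y] /= /andP[/eqP xy1 /eqP Txy].
    set u := ((2 * x + y) %/ 5)%Z; set v := ((2 * y - x) %/ 5)%Z.
    have [Ex Ey] : x = 2 * u - v /\ y = u + 2 * v + 1 by lia.
    have TE : (tri u + tri v = n)%N.
      have := triP u; have := triP v; have := triP x; have := triP y; move: Txy.
      move: (tri u) (tri v) (tri x) (tri y) => U V X Y.
      rewrite Ex Ey; nia.
    by rewrite TE eqxx mem_int_box ?TE.
  by move=> [x y] [x' y'] /= /andP[/eqP ? _] /andP[/eqP ? _] [? ?]; congr (_, _); lia.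
apply: (@leq_count _ _ (fun z => (2 * z.1 - z.2, z.1 + 2 * z.2 + 1))).
- exact: uniq_int_box.
- move=> [x y] /= /eqP Txy.
  have TE : (tri (2 * x - y) + tri (x + 2 * y + 1) = 5 * n + 1)%N.
    have := triP x; have := triP y; have := triP (2 * x - y); have := triP (x + 2 * y + 1).
    by move: Txy; move: (tri x) (tri y) (tri _) (tri _) => X Y U V; nia.
  by rewrite TE eqxx andbT mem_int_box ?TE //; split=> //; lia.
by move=> [x y] [x' y'] /= _ _ [? ?]; congr (_, _); lia.
Qed.

Section Theta.
Variable R : comNzRingType.

(** The sum of q^(tri x) over the integers x in [P], folded onto k >= 0 by the reflection of x into
    -1-x. *)
Definition theta (P : pred int) : fps R :=
  tri_series (fun k => (P (Posz k))%:R + (P (Negz k))%:R).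

Lemma theta_int_range P n N : (n <= N)%N ->
  theta P n = \sum_(x <- int_range N | tri x == n) (P x)%:R.
Proof.
move=> le_nN; rewrite /theta (tri_series_widen _ le_nN) big_split /=.
have iotaE (w : nat -> R) : \sum_(k < N.+1 | 'C(k.+1, 2) == n) w k =
    \sum_(k <- iota 0 N.+1 | 'C(k.+1, 2) == n) w k.
  by rewrite -(big_mkord (fun k => 'C(k.+1, 2) == n) w) /index_iota subn0.
rewrite big_cat !big_map; congr (_ + _).
  exact: (iotaE (fun k => (P (Posz k))%:R)).
exact: (iotaE (fun k => (P (Negz k))%:R)).
Qed.

Lemma theta_mul P Q n : (theta P * theta Q) n =
  (count (fun z : int * int => P z.1 && Q z.2 && (tri z.1 + tri z.2 == n)%N)
    (int_box n))%:R.
Proof.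
rewrite fps_coefM -sum1_count natr_sum [RHS]big_mkcond /int_box [RHS]big_allpairs_dep /=.
transitivity (\sum_(i < n.+1) \sum_(x <- int_range n) \sum_(y <- int_range n)
    if (tri x == i) && (tri y == n - i)%N then (P x && Q y)%:R else 0 : R).
  apply: eq_bigr => i _; have le_in : (i <= n)%N by rewrite -ltnS.
  rewrite (theta_int_range P le_in) (theta_int_range Q (leq_subr i n)) big_distrlr /=.
  rewrite big_mkcond; apply: eq_bigr => x _; case: eqP => _ /=; last by rewrite big1.
  by rewrite big_mkcond; apply: eq_bigr => y _; rewrite -mulnb natrM.
rewrite exchange_big; apply: eq_bigr => x _; rewrite exchange_big; apply: eq_bigr => y _.
have -> : (\sum_(i < n.+1) if (tri x == i) && (tri y == n - i)%N then (P x && Q y)%:R else 0 : R)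
    = \sum_(i < n.+1 | i == tri x :> nat) if (tri y == n - i)%N then (P x && Q y)%:R else 0.
  rewrite [RHS]big_mkcond; apply: eq_bigr => i _; rewrite eq_sym.
  by case: eqP.
rewrite (big_ord1_eq _ (fun i => if (tri y == n - i)%N then (P x && Q y)%:R else 0)) ltnS.
have -> : (tri x + tri y == n)%N = (tri x <= n)%N && (tri y == n - tri x)%N by lia.
by case: (P x && Q y); case: ifP => //=; case: ifP.
Qed.

End Theta.

(** * The 5-dissection of psi and its quadratic identity *)

Lemma triangular_double k : (2 * 'C(k.+1, 2) = k.+1 * k)%N.
Proof. by rewrite -mul_bin_diag bin1. Qed.

Lemma triangular_mod5 k : ('C(k.+1, 2) %% 5 = 'C((k %% 5).+1, 2) %% 5)%N.
Proof.
set b := (k %% 5)%N; set a := (k %/ 5)%N.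
have : (2 * 'C(k.+1, 2) = 2 * 'C(b.+1, 2) + 5 * (a * (5 * a + 2 * b + 1)))%N.
  by rewrite !triangular_double (divn_eq k 5) -/a -/b; ring.
lia.
Qed.

Lemma dissect_tri_series (R : comNzRingType) s (w w' : nat -> R) : (s < 5)%N ->
    (forall k, ('C((k %% 5).+1, 2) %% 5 = s)%N -> w k = w' k) ->
  dissect s (tri_series w) = dissect s (tri_series w').
Proof.
move=> lt_s5 ww'; apply/funext => n; apply: eq_bigr => k /eqP Tk; apply: ww'.
by rewrite -triangular_mod5 Tk; lia.
Qed.

Lemma tri_series0 (R : comNzRingType) : tri_series (fun=> 0 : R) = 0.
Proof. by apply/funext => n; rewrite /tri_series big1 // fps_coef0. Qed.

Lemma dissect_tri_series0 (R : comNzRingType) s (w : nat -> R) : (s < 5)%N ->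
    (forall k, ('C((k %% 5).+1, 2) %% 5 = s)%N -> w k = 0) ->
  dissect s (tri_series w) = 0.
Proof.
move=> lt_s5 w0; rewrite (dissect_tri_series lt_s5 w0) tri_series0.
by apply/funext => n; rewrite /dissect !fps_coef0.
Qed.

Lemma tri_seriesD (R : comNzRingType) (w w' : nat -> R) :
  tri_series (fun k => w k + w' k) = tri_series w + tri_series w'.
Proof. by apply/funext => n; rewrite /tri_series big_split. Qed.

Section PsiDissection.
Variable R : comNzRingType.

(** Triangular numbers are 0, 1 or 3 modulo 5. *)
Lemma dissect_psi24 s : (s == 2)%N || (s == 4)%N -> dissect s (psi R) = 0.
Proof.
move=> s24; apply: dissect_tri_series0 => [|k]; first by lia.
by move: (k %% 5)%N (ltn_pmod k (isT : 0 < 5)%N) => [|[|[|[|[|]]]]] // _;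
  move: s24 => /orP[] /eqP->.
Qed.

Definition residue (r : nat) : pred int := fun x => (x %% 5)%Z == Posz r.

Lemma theta_residue r : (r < 5)%N -> theta R (residue r) =
  tri_series (fun k => ((k %% 5 == r) + (k %% 5 == 4 - r))%N%:R).
Proof.
move=> lt_r5; apply/funext => n; apply: eq_bigr => k _; rewrite -natrD.
by congr (_ + _)%N%:R; rewrite /residue; congr (nat_of_bool _); rewrite ?NegzE; lia.
Qed.

Lemma theta_residue_rev (r : nat) : (r < 5)%N ->
  theta R (residue (4 - r)) = theta R (residue r).
Proof.
move=> lt_r5; rewrite !theta_residue //; last lia.
apply/funext => n; apply: eq_bigr => k _; rewrite addnC.
by congr (_ + _)%N%:R; congr (nat_of_bool _); lia.
Qed.

Lemma theta_predT : theta R predT = psi R + psi R.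
Proof. by rewrite -tri_seriesD. Qed.

Lemma dissect_theta0 r s : (r < 5)%N -> (s < 5)%N -> ('C(r.+1, 2) %% 5 != s)%N ->
  dissect s (theta R (residue r)) = 0.
Proof.
move=> lt_r5 lt_s5 rs; rewrite theta_residue //.
apply: dissect_tri_series0 => // k Tk.
have kr : (k %% 5 == r)%N = false by apply: contraNF rs => /eqP <-; rewrite Tk.
have kr' : (k %% 5 == 4 - r)%N = false.
  apply: contraNF rs => /eqP E; rewrite -Tk E.
  by move: r lt_r5 {E kr} => [|[|[|[|[|]]]]].
by rewrite kr kr'.
Qed.

Lemma dissect0_theta : dissect 0 (theta R (residue 0)) = dissect 0 (psi R).
Proof.
rewrite theta_residue //; apply: dissect_tri_series => // k.
by move: (k %% 5)%N (ltn_pmod k (isT : 0 < 5)%N) => [|[|[|[|[|]]]]] // _.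
Qed.

Lemma dissect1_theta : dissect 1 (theta R (residue 1)) = dissect 1 (psi R).
Proof.
rewrite theta_residue //; apply: dissect_tri_series => // k.
by move: (k %% 5)%N (ltn_pmod k (isT : 0 < 5)%N) => [|[|[|[|[|]]]]] // _.
Qed.

(** Residue 2 is its own mirror image under x to -1-x, so both k and -1-k count. *)
Lemma dissect3_theta :
  dissect 3 (theta R (residue 2)) = dissect 3 (psi R) + dissect 3 (psi R).
Proof.
rewrite theta_residue // -dissectD -tri_seriesD; apply: dissect_tri_series => // k.
by move: (k %% 5)%N (ltn_pmod k (isT : 0 < 5)%N) => [|[|[|[|[|]]]]] // _.
Qed.

Lemma psi_count n : psi R n = (count (fun k => 'C(k.+1, 2) == n) (iota 0 n.+1))%:R.
Proof.
rewrite /psi /tri_series -(big_mkord (fun k => 'C(k.+1, 2) == n) (fun=> 1)).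
by rewrite /index_iota subn0 -sum1_count natr_sum.
Qed.

(** T k = 3 mod 5 forces k = 5m + 2, and T(5m + 2) = 25 T m + 3. *)
Lemma dissect3_psi : dissect 3 (psi R) = dilate (psi R).
Proof.
apply/funext => n; rewrite /dissect /dilate !psi_count.
have T5 m : 'C((5 * m + 2).+1, 2) = (25 * 'C(m.+1, 2) + 3)%N.
  have : (2 * 'C((5 * m + 2).+1, 2) = 25 * (2 * 'C(m.+1, 2)) + 6)%N.
    by rewrite !triangular_double; ring.
  by lia.
have mod2 k : 'C(k.+1, 2) = (5 * n + 3)%N -> k = (5 * (k %/ 5) + 2)%N.
  move=> Tk; have : ('C((k %% 5).+1, 2) %% 5 = 3)%N by rewrite -triangular_mod5 Tk; lia.
  by have := ltn_pmod k (isT : 0 < 5)%N; case E: (k %% 5)%N => [|[|[|[|[|]]]]] // _ _; lia.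
have in_iota k N : ('C(k.+1, 2) = N -> k \in iota 0 N.+1)%N.
  by move=> <-; rewrite mem_iota ltnS leq_triangular.
case: ifP => n5; last first.
  rewrite (_ : count _ _ = 0%N) //; apply/eqP; rewrite -leqn0 leqNgt -has_count.
  apply/hasPn => k _; apply/eqP => Tk; have := T5 (k %/ 5)%N.
  by rewrite -(mod2 _ Tk) Tk; lia.
congr _%:R; apply/eqP; rewrite eqn_leq; apply/andP; split.
  apply: (@leq_count _ _ (fun k => k %/ 5)%N) => [|k /eqP Tk|k k' /eqP Tk /eqP Tk'].
  - exact: iota_uniq.
  - have Tm : 'C((k %/ 5).+1, 2) = (n %/ 5)%N.
      by have := T5 (k %/ 5)%N; rewrite -(mod2 _ Tk) Tk; lia.
    by rewrite Tm eqxx in_iota.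
  by move=> E; rewrite (mod2 _ Tk) (mod2 _ Tk') E.
apply: (@leq_count _ _ (fun m => 5 * m + 2)%N) => [|m /eqP Tm|m m' _ _]; last lia.
  exact: iota_uniq.
have Tk : 'C((5 * m + 2).+1, 2) = (5 * n + 3)%N by rewrite T5 Tm; lia.
by rewrite Tk eqxx in_iota.
Qed.


(** The products run over the residue pairs (r, s) with 2r + s = 1 mod 5, the condition in
    [count_box]. *)
Lemma theta_multiplication : theta R predT ^+ 2 =
  dissect 1 (theta R (residue 0) * theta R (residue 1)
    + theta R (residue 1) * theta R (residue 4)
    + theta R (residue 2) * theta R (residue 2)
    + theta R (residue 3) * theta R (residue 0)
    + theta R (residue 4) * theta R (residue 3)).
Proof.
apply/funext => n; rewrite !dissectD !fps_coefD expr2 theta_mul /dissect !theta_mul -!natrD.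
congr _%:R; rewrite -[LHS]count_box.
have split_residues x y : (((2 * x + y) %% 5)%Z == 1) =
    ((residue 0 x && residue 1 y) + (residue 1 x && residue 4 y)
    + (residue 2 x && residue 2 y) + (residue 3 x && residue 0 y)
    + (residue 4 x && residue 3 y))%N :> nat.
  by rewrite /residue; lia.
elim: (int_box _) => //= -[x y] s /= ->.
case: (_ == _ + 1)%N; rewrite ?andbT ?andbF ?add0n // split_residues; lia.
Qed.


(** Residues 3 and 4 mirror 1 and 0, so four of the five products contribute a b each, and the
    square of residue 2 contributes q (2c)^2. *)
Lemma psi_identity : 4 * (dissect 0 (psi R) * dissect 1 (psi R)
   + fpsX R * dissect 3 (psi R) ^+ 2) = 4 * psi R ^+ 2.
Proof.
have th3 : theta R (residue 3) = theta R (residue 1) by exact: (@theta_residue_rev 1).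
have th4 : theta R (residue 4) = theta R (residue 0) by exact: (@theta_residue_rev 0).
have := theta_multiplication; rewrite theta_predT th3 th4 !dissectD !dissect1M.
rewrite dissect0_theta dissect1_theta dissect3_theta !dissect_theta0 // => E.
transitivity ((psi R + psi R) ^+ 2); last by ring.
by rewrite E; ring.
Qed.


End PsiDissection.

(** * Congruences modulo 5 *)

Lemma agree_uptoX (R : comNzRingType) n (f : fps R) p k :
  agree_upto n f p -> agree_upto n (f ^+ k) (p ^+ k).
Proof.
move=> fp; elim: k => [|k IHk]; first by move=> i _; rewrite !expr0.
by rewrite !exprS; apply: agree_uptoM.
Qed.

Section Modulo5.
Variable R : comNzRingType.
Hypothesis pchar5 : 5%N \in [pchar R].
Implicit Types f g : fps R.

Lemma fps_five : 5 = 0 :> fps R.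
Proof.
apply/funext => n; rewrite -[5]mul1r fps_coef_natM fps_coef0.
by have := pcharf0 pchar5 => /= ->; rewrite mulr0.
Qed.

(** Fifth powers are additive in characteristic 5 and fix each coefficient, so only q changes, into
    q^5. *)
Lemma fps_frobenius f : (forall i, f i ^+ 5 = f i) -> f ^+ 5 = dilate f.
Proof.
move=> f5; apply/funext => n; have pchar5P : 5%N \in [pchar {poly R}] by rewrite pchar_poly.
rewrite (agree_uptoX 5 (@agree_upto_trunc _ n f) (leqnn n)) poly_def.
rewrite -(pFrobenius_autE pchar5P) rmorph_sum coef_sum /dilate.
transitivity (\sum_(i < n.+1 | i == (n %/ 5)%N :> nat) if (5 %| n)%N then f i else 0).
  rewrite [RHS]big_mkcond; apply: eq_bigr => i _; rewrite /= pFrobenius_autE exprZn f5.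
  rewrite -exprM coefZ coefXn; case: (boolP (5 %| n)%N) => n5; case: eqP => ni; case: eqP => ni' //;
    rewrite ?mulr0 ?mulr1 //; lia.
rewrite (big_ord1_eq _ (fun i => if (5 %| n)%N then f i else 0)) ifT //; lia.
Qed.

Lemma psi_frobenius : psi R ^+ 5 = dilate (psi R).
Proof.
apply: fps_frobenius => i; rewrite psi_count -(pFrobenius_autE pchar5).
exact: pFrobenius_aut_nat.
Qed.

Let a := dissect 0 (psi R).
Let b := dissect 1 (psi R).
Let c := dissect 3 (psi R).

Lemma eq_mod5 f g h : f = g + 5 * h -> f = g.
Proof. by move=> ->; rewrite fps_five mul0r addr0. Qed.

Lemma psi_identity5 : a * b + fpsX R * c ^+ 2 = psi R ^+ 2.
Proof.
have /eqP := psi_identity R; rewrite -/a -/b -/c -subr_eq0 -mulrBr => /eqP E.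
set u := a * b + _ in E *.
(* The factor 4 of [psi_identity] is -1 modulo 5. *)
apply: (@eq_mod5 _ _ (u - psi R ^+ 2)).
transitivity (psi R ^+ 2 + 5 * (u - psi R ^+ 2) - 4 * (u - psi R ^+ 2)); first by ring.
by rewrite E subr0.
Qed.

Lemma dissect_mul_dilate r f g : (r < 5)%N ->
  dissect r (f * dilate g) = dissect r f * g.
Proof.
by case: r => [|[|[|[|[|//]]]]] _; rewrite dissect_mul dissect_dilate0 !dissect_dilate //; ring.
Qed.

Lemma dissectXM r f : dissect r.+1 (fpsX R * f) = dissect r f.
Proof. by apply/funext => n; rewrite /dissect addnS fps_coefXM. Qed.

Let psi_dissect := (@dissect_psi24 R 2 isT, @dissect_psi24 R 4 isT).

(** The components of psi^2 are a^2, 2ab + qc^2, b^2, 2ac, 2bc, which gives 6 a^2 b^2 + 12 q a b c^2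
    + q^2 c^4, congruent to (ab + qc^2)^2. *)
Lemma dissect2_psi4 : dissect 2 (psi R ^+ 4) = psi R ^+ 4.
Proof.
transitivity ((a * b + fpsX R * c ^+ 2) ^+ 2); last by rewrite psi_identity5; ring.
have -> : psi R ^+ 4 = (psi R * psi R) * (psi R * psi R) by ring.
rewrite !dissect_mul !psi_dissect -/a -/b -/c.
apply: (@eq_mod5 _ _ (a ^+ 2 * b ^+ 2 + 2 * fpsX R * a * b * c ^+ 2)); ring.
Qed.

(** Expansion gives 6abc + q c^3, which is c (ab + qc^2) up to 5abc. *)
Lemma dissect4_psi3 : dissect 4 (psi R ^+ 3) = psi R ^+ 2 * dilate (psi R).
Proof.
rewrite -dissect3_psi -/c -psi_identity5 !exprS expr0 mulr1 !dissect_mul !psi_dissect -/a -/b -/c.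
apply: (@eq_mod5 _ _ (a * b * c)); ring.
Qed.

Lemma dissect1_psi2 : dissect 1 (psi R ^+ 2) = 2 * psi R ^+ 2 - fpsX R * dilate (psi R) ^+ 2.
Proof.
rewrite -[in RHS]psi_identity5 -dissect3_psi -/c !expr2 !dissect_mul !psi_dissect -/a -/b -/c; ring.
Qed.

Lemma dissect1_psi3 : dissect 1 (psi R ^+ 3) = 3 * a * psi R ^+ 2.
Proof.
rewrite -psi_identity5 !exprS expr0 !mulr1 !dissect_mul !psi_dissect -/a -/b -/c; ring.
Qed.

Lemma dissect2_psi3 : dissect 2 (psi R ^+ 3) = 3 * b * psi R ^+ 2.
Proof.
rewrite -psi_identity5 !exprS expr0 !mulr1 !dissect_mul !psi_dissect -/a -/b -/c; ring.
Qed.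

(** * The reciprocal of psi modulo 5 *)

Variable u : fps R.
Hypothesis psi_u : psi R * u = 1.

(** The factor psi(q^5) = psi^5 passes through U 2 and turns 1/psi into psi^4. *)
Lemma dissect2_inv_psi : dissect 2 u = psi R ^+ 3.
Proof.
have E : dissect 2 u * psi R = psi R ^+ 4.
  rewrite -dissect_mul_dilate // -psi_frobenius -[RHS]dissect2_psi4 exprS mulrA.
  by rewrite [u * _]mulrC psi_u mul1r.
by rewrite -[LHS]mulr1 -psi_u mulrA E exprS [psi R * _]mulrC -mulrA psi_u mulr1.
Qed.

Definition inv_psi_subseries : fps R := dissect 1 (dissect 4 (dissect 2 u)).

Lemma inv_psi_subseriesE : inv_psi_subseries =
  2 * psi R ^+ 3 - fpsX R * (psi R * dilate (psi R) * dilate (psi R)).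
Proof.
rewrite /inv_psi_subseries dissect2_inv_psi dissect4_psi3 dissect_mul_dilate // dissect1_psi2.
ring.
Qed.

(** The shift by q lowers the residue of the second term by one, so both terms are multiples of the
    same product: 2 * 3a - a = 5a for r = 1, and likewise 5b for r = 2. *)
Lemma dissect_inv_psi_subseries r : (r == 1%N) || (r == 2%N) -> dissect r inv_psi_subseries = 0.
Proof.
have E s : (s < 4)%N -> dissect s.+1 inv_psi_subseries =
    2 * dissect s.+1 (psi R ^+ 3) - dissect s (psi R) * psi R ^+ 2.
  move=> lt_s4; rewrite inv_psi_subseriesE dissectD dissectN dissectXM.
  have -> : 2 * psi R ^+ 3 = psi R ^+ 3 + psi R ^+ 3 by ring.
  by rewrite !dissect_mul_dilate 1?ltnW // dissectD mulr_natl mulr2n -mulrA -expr2.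
case/orP => /eqP ->; rewrite E //.
  by rewrite dissect1_psi3 -/a; apply: (@eq_mod5 _ _ (a * psi R ^+ 2)); ring.
by rewrite dissect2_psi3 -/b; apply: (@eq_mod5 _ _ (b * psi R ^+ 2)); ring.
Qed.

(** The nested extraction reads index 5(5(5(5n + r) + 1) + 4) + 2. *)
Lemma inv_psi_coef0 n r : (r == 1%N) || (r == 2%N) -> u (625 * n + (125 * r + 47))%N = 0.
Proof.
move=> /dissect_inv_psi_subseries /(congr1 (fun f : fps R => f n)).
rewrite fps_coef0 => <-; rewrite /inv_psi_subseries /dissect; congr u; lia.
Qed.

End Modulo5.

(** * Binomials modulo 5 and the final convolution *)

Lemma dvd5_bin N M : (25 %| M.+1)%N -> ~~ (25 %| N.+1)%N -> (5 %| 'C(N, M))%N.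
Proof.
(* In (N+1) C(N,M) = (M+1) C(N+1,M+1) the right side is divisible by 25, so a binomial prime to 5
   would force 25 to divide N+1. *)
move=> M25; apply: contraR => C5; rewrite -(@Gauss_dvdl _ _ 'C(N, M)).
  by have := mul_bin_diag N.+1 M; rewrite /= => ->; rewrite dvdn_mulr.
by rewrite (@coprimeXl 2 5) // prime_coprime.
Qed.

(** Here 2t + 1 = 50J + 25, while 25 divides m + t + 1 only if m = 25j + 12, and then T m = 625 T j
    + 78. *)
Lemma tri_series_eq0_mod625 (R : comNzRingType) J i : 5%N \in [pchar R] ->
  (i %% 625 != 78)%N ->
  tri_series (fun m => ('C(m + (25 * J + 12), (25 * J + 12).*2))%:R : R) i = 0.
Proof.
move=> pchar5 i78; rewrite /tri_series big1 // => m /eqP Tm.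
apply/eqP; rewrite -(dvdn_pcharf pchar5); apply: dvd5_bin; first by lia.
apply: contraNN i78 => m12.
rewrite -Tm; move: (nat_of_ord m) m12 => {Tm}k k12.
have -> : (k = 25 * (k %/ 25) + 12)%N by lia.
set j := (k %/ 25)%N.
have : (2 * 'C((25 * j + 12).+1, 2) = 625 * (2 * 'C(j.+1, 2)) + 156)%N.
  by rewrite !triangular_double; ring.
by lia.
Qed.

Definition fps_map_int (R : comNzRingType) (f : fps int) : fps R := fun n => (f n)%:~R.

Lemma fps_map_intM (R : comNzRingType) f g :
  fps_map_int R (f * g) = fps_map_int R f * fps_map_int R g.
Proof.
apply/funext => n; rewrite /fps_map_int !fps_coefM rmorph_sum.
by apply: eq_bigr => i _; rewrite rmorphM.
Qed.

Lemma fps_map_int_tri_series (R : comNzRingType) (w : nat -> nat) :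
  fps_map_int R (tri_series (fun m => (w m)%:R)) = tri_series (fun m => (w m)%:R).
Proof.
apply/funext => n; rewrite /fps_map_int /tri_series rmorph_sum.
by apply: eq_bigr => i _; rewrite rmorph_nat.
Qed.

Lemma intr_Fp_eq0 p (x : int) : prime p -> x%:~R = 0 :> 'F_p -> (x = 0 %[mod p])%Z.
Proof.
move=> p_pr; rewrite {1}(intEsign x) rmorphM rmorph_sign => /eqP.
rewrite mulf_eq0 signr_eq0 /= -pmulrn -(dvdn_pcharf (pchar_Fp p_pr)) => px.
by apply/eqP; rewrite eqz_mod_dvd subr0 dvdzE.
Qed.


Lemma MO2_mod5 J N r : (r == 1%N) || (r == 2%N) ->
  (MO 2 (25 * J + 12) (625 * N + (125 * r + 125)) = 0 %[mod 5])%Z.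
Proof.
move=> r12; apply: (@intr_Fp_eq0 5) => //; have pchar5 := pchar_Fp (isT : prime 5).
set t := (25 * J + 12)%N; set n := (625 * N + _)%N.
pose u := fps_inv (psi 'F_5).
have psi_u : psi 'F_5 * u = 1 by rewrite fps_mulrV ?psi_coef0.
have := congr1 (fps_map_int 'F_5) (psi_MO2 t).
rewrite fps_map_intM fps_map_int_tri_series (fps_map_int_tri_series _ (fun=> 1%N)).
move=> /(congr1 (fun f => f * u)); rewrite mulrAC psi_u mul1r.
move=> /(congr1 (fun f : fps 'F_5 => f n)); rewrite {1}/fps_map_int => ->.
(* If i = 78 mod 625, the complementary index is 125r + 125 - 78 = 125r + 47 mod 625, where 1/psi
   vanishes. *)
rewrite fps_coefM big1 // => i _; have [i78|i78] := eqVneq (i %% 625)%N 78%N; last first.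
  by rewrite tri_series_eq0_mod625 ?mul0r.
have -> : (n - i = 625 * (N - i %/ 625) + (125 * r + 47))%N.
  by rewrite /n; have := ltn_ord i; rewrite /n; move: r12; lia.
by rewrite (inv_psi_coef0 pchar5 psi_u) ?mulr0.
Qed.

Theorem theorem5p2 (J N : nat) :
  (MO 2 (25 * J + 12) (625 * N + 250) = 0 %[mod 5])%Z /\
  (MO 2 (25 * J + 12) (625 * N + 375) = 0 %[mod 5])%Z.
Proof. by split; [exact: (@MO2_mod5 J N 1) | exact: (@MO2_mod5 J N 2)]. Qed.
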